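(* Let $k$ be an algebraically closed field, $Q$ a quiver, $d=(d_a)_{a\in Q_0}$ a dimension vector with all $d_a>0$, and $\theta$ a rational weight of $Q$. Let $\tilde Q$ be the covering quiver of $Q$ with respect to $d$, with weight $\tilde\theta$ and dimension vector $\mathbf{1}$. Let $p:\mathcal{A}^{\mathrm{s}}\to N$ be the quotient map onto the moduli space $N$ of $\theta$-stable representations of $Q$ of type $d$, and let $\tilde p:\tilde{\mathcal{A}}^{\mathrm{s}}\to\tilde N$ be the GIT quotient by the group $T$ onto the moduli space $\tilde N$ of $\tilde\theta$-stable representations of $\tilde Q$ of type $\mathbf{1}$. Then there is a surjective map $$\tau_N:\tilde N\to N,\qquad[\tilde V]\mapsto[V],$$ satisfying $p\circ\varphi=\tau_N\circ\tilde p$, where $\varphi$ is the identification of $\tilde{\mathcal{A}}^{\mathrm{s}}$ and $\mathcal{A}^{\mathrm{s}}$ (the restriction of the identification $\varphi:\mathcal{A}(\tilde Q,\mathbf{1})\to\mathcal{A}(Q,d)$).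
   Context: A quiver $Q=(Q_0,Q_1,\mathrm{s},\mathrm{t})$ consists of finite sets $Q_0\neq\emptyset$, $Q_1$ and maps $\mathrm{s},\mathrm{t}:Q_1\to Q_0$. A representation over $k$ is a family $(V_a)_{a\in Q_0}$ of finite-dimensional vector spaces with linear maps $\rho_\alpha:V_{\mathrm{s}(\alpha)}\to V_{\mathrm{t}(\alpha)}$. For a weight $\theta\in\mathbf{R}^{Q_0}$, $\mu_\theta(V,\rho)=\left(\sum_a\theta_a\dim V_a\right)/\left(\sum_a\dim V_a\right)$; a non-zero representation is $\theta$-stable if every non-zero proper subrepresentation has strictly smaller slope. Fix vector spaces $V_a$ of dimension $d_a$ with ordered bases. $\mathcal{A}=\mathcal{A}(Q,d)=\bigoplus_{\alpha\in Q_1}\mathrm{Hom}(V_{\mathrm{s}(\alpha)},V_{\mathrm{t}(\alpha)})$; $G=\prod_a\mathrm{Aut}(V_a)$ acts on the right by $(\rho g)_\alpha=g_{\mathrm{t}(\alpha)}^{-1}\rho_\alpha g_{\mathrm{s}(\alpha)}$; $\Delta$ is the subgroup of scalars $(c\mathbf{1}_{V_a})_a$, $c\in k^\times$, and $\bar G=\Delta\backslash G$. $\mathcal{A}^{\mathrm{s}}$ is the set of $\rho$ with $(V,\rho)$ $\theta$-stable, and $p:\mathcal{A}^{\mathrm{s}}\to N$ is the geometric quotient by $\bar G$; $[V]$ denotes the isomorphism class of a stable representation $V$, viewed as a point of $N$. The covering quiver $\tilde Q$ has vertices $(a,\mu)$ with $a\in Q_0$, $1\le\mu\le d_a$, and arrows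 $(\alpha,\mu,\nu)$ with $\alpha\in Q_1$, $1\le\mu\le d_{\mathrm{s}(\alpha)}$, $1\le\nu\le d_{\mathrm{t}(\alpha)}$, going from $(\mathrm{s}(\alpha),\mu)$ to $(\mathrm{t}(\alpha),\nu)$. Its weight is $\tilde\theta_{(a,\mu)}=\theta_a$, and $\mathbf{1}$ is the dimension vector with all entries $1$. For a representation $V=(V,\rho)$ of $Q$, the covering representation $\tilde V$ has $\tilde V_{(a,\mu)}$ the line spanned by the $\mu$-th basis vector of $V_a$, and $\tilde\rho_{(\alpha,\mu,\nu)}$ the $(\mu,\nu)$-th matrix entry of $\rho_\alpha$ (component from the $\mu$-th basis line of $V_{\mathrm{s}(\alpha)}$ to the $\nu$-th basis line of $V_{\mathrm{t}(\alpha)}$). Conversely every representation of $\tilde Q$ on these lines arises from a unique $\rho\in\mathcal{A}$; this gives the identification $\varphi:\mathcal{A}(\tilde Q,\mathbf{1})\to\mathcal{A}(Q,d)$, $\tilde\rho\mapsto\rho$. $\tilde{\mathcal{A}}=\mathcal{A}(\tilde Q,\mathbf{1})$, $\tilde{\mathcal{A}}^{\mathrm{s}}$ is its $\tilde\theta$-stable locus, and $T=\Delta'\backslash\prod_{(a,\mu)}\mathbb{G}_m$ with $\Delta'=\{(\lambda)_{(a,\mu)}\mid\lambda\in k^\times\}$, acting on the right on $\tilde{\mathcal{A}}$ by $(\tilde\rho\,t)_{(\alpha,\mu,\nu)}=t_{(\mathrm{t}(\alpha),\nu)}^{-1}\,\tilde\rho_{(\alpha,\mu,\nu)}\,t_{(\mathrm{s}(\alpha),\mu)}$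 for $t=(t_{(a,\mu)})_{(a,\mu)}$; $\tilde N$ is the quotient of $\tilde{\mathcal{A}}^{\mathrm{s}}$ by $T$.
   Formalization: φ need not map the stable locus of Q̃ into that of Q (one loop, d=2, swap matrix), so the map from all of Ñ is shown only when it does; in general τ_N is given on the classes [Ṽ] with V stable, where it is surjective onto N and satisfies p∘φ=τ_N∘p̃. *)

(* Defs.v *)
From HB Require Import structures.
From mathcomp Require Import all_boot all_order all_algebra.
From mathcomp Require Import boolp classical_sets functions topology.
Set Implicit Arguments.
Unset Strict Implicit.
Unset Printing Implicit Defensive.
Import Order.TTheory GRing.Theory Num.Theory.
Local Open Scope classical_set_scope.
Local Open Scope ring_scope.

Record quiver := Quiver {
  vertex : finType;
  arrow : finType;
  src : arrow -> vertex;
  tgt : arrow -> vertex;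
  vertex_inh : (0 < #|vertex|)%N }.

(* The space A(Q, d), with V_a = 'rV_(d a).  Row vectors are used, so that rho_alpha
   is the map v |-> v *m rho alpha and (rho alpha) mu nu is its component from
   the mu-th basis line of the source to the nu-th basis line of the target. *)
Definition rep (k : fieldType) (Q : quiver) (d : vertex Q -> nat) : Type :=
  forall alpha : arrow Q, 'M[k]_(d (src alpha), d (tgt alpha)).

Definition slope (Q : quiver) (theta : vertex Q -> rat)
    (e : vertex Q -> nat) : rat :=
  (\sum_a theta a * (e a)%:R) / (\sum_a (e a)%:R).

(* A family of subspaces is given by the row spaces of square matrices. *)
Definition subrep (k : fieldType) (Q : quiver) (d : vertex Q -> nat)
    (rho : rep k d) (U : forall a, 'M[k]_(d a)) : Prop :=
  forall alpha, (U (src alpha) *m rho alpha <= U (tgt alpha))%MS.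

Definition stable (k : fieldType) (Q : quiver) (d : vertex Q -> nat)
    (theta : vertex Q -> rat) (rho : rep k d) : Prop :=
  (exists a, (0 < d a)%N) /\
  forall U : (forall a, 'M[k]_(d a)), subrep rho U ->
    (exists a, (0 < \rank (U a))%N) ->
    (exists a, (\rank (U a) < d a)%N) ->
    slope theta (fun a => \rank (U a)) < slope theta d.

(* With row vectors the composite g_t^-1 rho g_s is written in the reverse
   order. *)
Definition rep_act (k : fieldType) (Q : quiver) (d : vertex Q -> nat)
    (rho : rep k d) (g : forall a, 'M[k]_(d a)) : rep k d :=
  fun alpha => g (src alpha) *m rho alpha *m invmx (g (tgt alpha)).

(* The scalars act trivially, so the orbits of the quotient of
   \prod_a Aut(V_a) by the scalars are those of \prod_a Aut(V_a). *)
Definition same_orbit (k : fieldType) (Q : quiver) (d : vertex Q -> nat)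
    (rho rho' : rep k d) : Prop :=
  exists2 g : (forall a, 'M[k]_(d a)),
    forall a, g a \in unitmx & rho' = rep_act rho g.

Inductive polynomial_fun (k : fieldType) (Q : quiver) (d : vertex Q -> nat) :
    (rep k d -> k) -> Prop :=
| polynomial_cst c : polynomial_fun (fun=> c)
| polynomial_coord alpha i j : polynomial_fun (fun rho => rho alpha i j)
| polynomial_add f g : polynomial_fun f -> polynomial_fun g ->
    polynomial_fun (fun rho => f rho + g rho)
| polynomial_mul f g : polynomial_fun f -> polynomial_fun g ->
    polynomial_fun (fun rho => f rho * g rho).

(* Spaces with k-valued functions, as models of varieties over an algebraically
   closed field.  [regular U f] means that the restriction of f to the open set U
   is a section of the structure sheaf; the values of f outside U play no role
   in the instances below. *)
Record fun_space (k : fieldType) := FunSpace {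
  fs_sort :> topologicalType;
  regular : set fs_sort -> set (fs_sort -> k) }.

Definition fs_morphism (k : fieldType) (X Y : fun_space k) (f : X -> Y) : Prop :=
  continuous f /\
  forall (U : set Y) (u : Y -> k), open U -> regular U u ->
    regular (f @^-1` U) (u \o f).

(* Geometric quotient of X by a group whose orbit relation is E.  In the last
   clause the functions u \o p are exactly the invariant functions on p^-1(U),
   so it says that the sections on U are the invariant regular functions on
   p^-1(U). *)
Definition geometric_quotient (k : fieldType) (X N : fun_space k)
    (E : X -> X -> Prop) (p : X -> N) : Prop :=
  [/\ forall y, exists x, p x = y,
      forall x x', p x = p x' <-> E x x',
      forall U : set N, open U <-> open (p @^-1` U)
    & forall (U : set N) (u : N -> k), open U ->
        (regular U u <-> regular (p @^-1` U) (u \o p))].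

Definition stable_rep (k : fieldType) (Q : quiver) (d : vertex Q -> nat)
  (theta : vertex Q -> rat) : Type := {rho : rep k d | stable theta rho}.

HB.instance Definition _ k Q d theta :=
  gen_eqMixin (@stable_rep k Q d theta).
HB.instance Definition _ k Q d theta :=
  gen_choiceMixin (@stable_rep k Q d theta).

Section Zariski.
Variables (k : fieldType) (Q : quiver) (d : vertex Q -> nat).
Variable theta : vertex Q -> rat.
Local Notation As := (@stable_rep k Q d theta).

Definition zariski_open (W : set As) : Prop :=
  forall x, W x -> exists h : rep k d -> k,
    [/\ polynomial_fun h, h (sval x) != 0
      & forall y : As, h (sval y) != 0 -> W y].

Lemma zariski_openT : zariski_open setT.
Proof.
move=> x _; exists (fun=> 1); split=> //; first exact: polynomial_cst.
exact: oner_neq0.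
Qed.

Lemma zariski_openI : setI_closed zariski_open.
Proof.
move=> A B oA oB x [/oA[f [pf fx fA]] /oB[g [pg gx gB]]].
exists (fun rho => f rho * g rho); split.
- exact: polynomial_mul.
- by rewrite mulf_neq0.
- by move=> y; rewrite mulf_eq0 negb_or => /andP[/fA ? /gB ?]; split.
Qed.

Lemma zariski_open_bigU (I : Type) (F : I -> set As) :
  (forall i, zariski_open (F i)) -> zariski_open (\bigcup_i F i).
Proof.
move=> oF x [i _ /oF[h [ph hx hF]]]; exists h; split=> // y /hF Fy.
by exists i.
Qed.

HB.instance Definition _ := isOpenTopological.Build As
  zariski_openT zariski_openI zariski_open_bigU.

Definition zariski_regular (W : set As) (u : As -> k) : Prop :=
  forall x, W x -> exists f h : rep k d -> k,
    [/\ polynomial_fun f, polynomial_fun h, h (sval x) != 0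
      & forall y : As, W y -> h (sval y) != 0 -> u y = f (sval y) / h (sval y)].

End Zariski.

(* The stable locus A^s as a subspace of the affine space A(Q, d). *)
Definition stable_locus (k : fieldType) (Q : quiver) (d : vertex Q -> nat)
    (theta : vertex Q -> rat) : fun_space k :=
  FunSpace (@zariski_regular k Q d theta).

Definition orbit_on_stable (k : fieldType) (Q : quiver) (d : vertex Q -> nat)
    (theta : vertex Q -> rat) (x y : stable_locus k d theta) : Prop :=
  same_orbit (sval x) (sval y).

(* p : A^s -> N exhibits N as the moduli space of theta-stable representations
   of dimension vector d. *)
Definition is_moduli (k : fieldType) (Q : quiver) (d : vertex Q -> nat)
    (theta : vertex Q -> rat) (N : fun_space k)
    (p : stable_locus k d theta -> N) : Prop :=
  geometric_quotient (@orbit_on_stable k Q d theta) p.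

Section Covering.
Variables (Q : quiver) (d : vertex Q -> nat) (d_gt0 : forall a, (0 < d a)%N).

Definition cover_vertex : finType := {a : vertex Q & 'I_(d a)}.
Definition cover_arrow : finType :=
  {alpha : arrow Q & ('I_(d (src alpha)) * 'I_(d (tgt alpha)))%type}.

Definition cover_src (x : cover_arrow) : cover_vertex :=
  Tagged (fun a => 'I_(d a)) (tagged x).1.
Definition cover_tgt (x : cover_arrow) : cover_vertex :=
  Tagged (fun a => 'I_(d a)) (tagged x).2.

Lemma cover_vertex_inh : (0 < #|cover_vertex|)%N.
Proof.
have /card_gt0P[a _] := vertex_inh Q.
by apply/card_gt0P; exists (Tagged (fun a => 'I_(d a)) (Ordinal (d_gt0 a))).
Qed.

Definition covering_quiver : quiver :=
  Quiver cover_src cover_tgt cover_vertex_inh.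

Definition cover_weight (theta : vertex Q -> rat) :
    vertex covering_quiver -> rat := fun x => theta (tag x).

Definition cover_dim : vertex covering_quiver -> nat := fun=> 1%N.

(* The identification A(~Q, 1) -> A(Q, d).  The group acting on A(~Q, 1) through
   [rep_act] is the torus of all families of 1 x 1 invertible matrices indexed
   by the pairs (a, mu).
   If phi rt is theta-stable then rt is stable, because subrepresentations of rt
   are the coordinate subrepresentations of phi rt.  The converse fails: for
   one loop and d = 2, the matrix with rows (0, 1) and (1, 0) gives a stable rt
   whereas phi rt has an eigenvector. *)
Definition phi (k : fieldType) (rt : rep k cover_dim) : rep k d :=
  fun alpha => \matrix_(mu, nu)
    rt (existT (fun alpha => ('I_(d (src alpha)) * 'I_(d (tgt alpha)))%type)
          alpha (mu, nu) : arrow covering_quiver) ord0 ord0.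

End Covering.

Arguments cover_dim {Q d} d_gt0 _.
Arguments cover_weight {Q d} d_gt0 theta _.

(* Main.v *)
(** A family of coordinate lines spans a subrepresentation of [phi rt] of the same
   slope, so [rt] is stable whenever [phi rt] is; in particular every stable [rho]
   is [phi rt] for some stable [rt].  The torus acts on [phi rt] through diagonal
   matrices, hence [p \o phi] is constant on the fibres of [pt] and factors
   through [pt].  Openness and regularity can be tested after pulling back along
   [pt], where they follow from [phi] being polynomial. *)
Require Import Defs.
From HB Require Import structures.
From mathcomp Require Import all_boot all_order all_algebra.
From mathcomp Require Import boolp classical_sets functions topology.
Set Implicit Arguments.
Unset Strict Implicit.
Unset Printing Implicit Defensive.
Import GRing.Theory.
Local Open Scope ring_scope.

(** * Matrices of size one and diagonal matrices *)

Lemma mx11E (R : nmodType) (A B : 'M[R]_1) : A 0 0 = B 0 0 -> A = B.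
Proof. by move=> AB; apply/matrixP => i j; rewrite !ord1. Qed.

Lemma rank_mx11 (k : fieldType) (A : 'M[k]_1) : \rank A = (A 0 0 != 0) :> nat.
Proof.
rewrite rank_rV; congr (nat_of_bool (~~ _)).
by apply/eqP/eqP => [->|A0]; [rewrite mxE | apply: mx11E; rewrite mxE].
Qed.

(** At a zero entry both sides are 0 by convention: [invmx] fixes singular matrices and the inverse
    of 0 in [k] is 0. *)
Lemma invmx11E (k : fieldType) (A : 'M[k]_1) : invmx A 0 0 = (A 0 0)^-1.
Proof. by rewrite {1}[A]mx11_scalar invmx_scalar mxE eqxx mulr1n. Qed.

(** Induction on [n]: the first entry splits off as a diagonal block of size one, and ranks of
    diagonal blocks add. This computes the dimension of a span of coordinate lines. *)
Lemma rank_diag_mx (k : fieldType) n (u : 'rV[k]_n) :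
  \rank (diag_mx u) = (\sum_i (u 0 i != 0)%R)%N.
Proof.
elim: n u => [|n IHn] u; first by rewrite big_ord0 [diag_mx u]thinmx0 mxrank0.
have -> : \rank (diag_mx u) = (\rank (diag_mx (@lsubmx _ 1 1 n u)) +
    \rank (diag_mx (@rsubmx _ 1 1 n u)))%N.
  by rewrite -rank_diag_block_mx -diag_mx_row hsubmxK.
rewrite big_ord_recl IHn rank_mx11; congr (_ + _)%N.
  by rewrite !mxE eqxx mulr1n; congr (nat_of_bool (u _ _ != 0)); apply: val_inj.
by apply: eq_bigr => i _; rewrite mxE; congr (nat_of_bool (u _ _ != 0));
  apply: val_inj.
Qed.

Lemma invmx_diag (k : fieldType) n (u : 'rV[k]_n) : (forall i, u 0 i != 0) ->
  invmx (diag_mx u) = diag_mx (\row_i (u 0 i)^-1).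
Proof.
move=> u0; set v := \row_i _.
have uv1 : diag_mx u *m diag_mx v = 1%:M.
  rewrite mul_diag_mx; apply/matrixP => i j; rewrite !mxE.
  case: eqVneq => [->|_]; last by rewrite !mulr0n mulr0.
  by rewrite !mulr1n mulfV.
by have [uU _] := mulmx1_unit uv1; rewrite -[RHS](mulKmx uU) uv1 mulmx1.
Qed.

(** * Stability and orbits under the covering identification *)

Section CoveringRepresentation.
Variables (k : fieldType) (Q : quiver) (d : vertex Q -> nat).
Variables (d_gt0 : forall a, (0 < d a)%N) (theta : vertex Q -> rat).
Local Notation dt := (cover_dim d_gt0).
Local Notation thetat := (cover_weight d_gt0 theta).
Local Notation vx a mu :=
  (Tagged (fun b => 'I_(d b)) (mu : 'I_(d a)) : vertex (covering_quiver d_gt0)).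

Local Notation ax al mu nu :=
  (Tagged (fun be => ('I_(d (src be)) * 'I_(d (tgt be)))%type) (mu, nu)
     : arrow (covering_quiver d_gt0)).

Definition covering_rep (rho : rep k d) : rep k dt :=
  fun x => const_mx (rho (tag x) (tagged x).1 (tagged x).2).

Lemma covering_repK : cancel covering_rep (@phi Q d d_gt0 k).
Proof.
move=> rho; apply: functional_extensionality_dep => al.
by apply/matrixP => i j; rewrite !mxE.
Qed.

Lemma phiE (rt : rep k dt) al mu nu :
  phi rt al mu nu = rt (ax al mu nu) 0 0.
Proof. by rewrite mxE. Qed.

(** [phi] only relabels matrix entries, so coordinate functions pull back to coordinate
    functions. *)
Lemma phi_polynomial (f : rep k d -> k) :
  polynomial_fun f -> polynomial_fun (f \o @phi Q d d_gt0 k).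
Proof.
elim=> [c|al i j|f1 f2 _ pf1 _ pf2|f1 f2 _ pf1 _ pf2].
- exact: polynomial_cst.
- rewrite (_ : _ \o _ = fun rt : rep k dt => rt (ax al i j) 0 0).
    exact: polynomial_coord.
  by apply: funext => rt; rewrite /= phiE.
- exact: polynomial_add.
- exact: polynomial_mul.
Qed.

Lemma sum_cover (F : vertex (covering_quiver d_gt0) -> rat) :
  \sum_x F x = \sum_a \sum_(mu < d a) F (vx a mu).
Proof.
rewrite (@sig_big_dep _ _ _ _ (fun a => 'I_(d a)) predT (fun=> predT)
  (fun a mu => F (vx a mu))).
by apply: eq_bigr => -[a mu] _.
Qed.

(** The weight is constant on the vertices over [a], so numerator and denominator can both be summed
    fibrewise. *)
Lemma slope_cover (e : vertex (covering_quiver d_gt0) -> nat) :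
  slope thetat e = slope theta (fun a => (\sum_(mu < d a) e (vx a mu))%N).
Proof.
rewrite /slope !sum_cover; congr (_ / _); apply: eq_bigr => a _.
  by rewrite natr_sum mulr_sumr.
by rewrite natr_sum.
Qed.

Lemma phi_stable (rt : rep k dt) : stable theta (phi rt) -> stable thetat rt.
Proof.
move=> [_ st]; split.
  by have /card_gt0P[x _] := vertex_inh (covering_quiver d_gt0); exists x.
move=> U subU [[a mu] Ua] [[b nu] Ub].
(* The row space of [W a] is spanned by the basis vectors [mu] of [V_a] at which [U] is non-zero. *)
pose W a := diag_mx (\row_mu (U (vx a mu) : 'M[k]_1) 0 0).
have rankW c : \rank (W c) = (\sum_(mu < d c) \rank (U (vx c mu)))%N.
  rewrite rank_diag_mx; apply: eq_bigr => i _.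
  by rewrite mxE (rank_mx11 (U (vx c i) : 'M[k]_1)).
have U1 c i : (\rank (U (vx c i)) <= 1)%N := rank_leq_row _.
rewrite (_ : slope thetat dt = slope theta d); last first.
  rewrite slope_cover; congr slope; apply: funext => c.
  by rewrite sum_nat_const card_ord muln1.
rewrite slope_cover; under [X in slope theta X]funext => c do rewrite -rankW.
apply: st.
- move=> al; apply/submxP.
  (* Since [W (tgt al)] is diagonal, a left factor is found by dividing column [j] by its [j]-th
     diagonal entry. *)
  exists (\matrix_(i, j) ((U (vx (src al) i) : 'M[k]_1) 0 0 *
     phi rt al i j / (U (vx (tgt al) j) : 'M[k]_1) 0 0)).
  rewrite mul_diag_mx mul_mx_diag; apply/matrixP => i j; rewrite !mxE.
  have [Uj0|Uj0] := eqVneq ((U (vx (tgt al) j) : 'M[k]_1) 0 0) 0; last first.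
    by rewrite divfK.
  rewrite Uj0 mulr0.
  (* Division by 0 gives a zero column in the factor, so the left side must vanish too: the arrow
     [(al, i, j)] maps the line of [U] at its source into the zero space. *)
  have /submxP[D] := subU (ax al i j).
  move=> /matrixP/(_ 0 0); rewrite !mxE !big_ord1 => ->.
  by rewrite [X in _ * X](_ : _ = 0) ?mulr0.
- exists a; rewrite rankW (bigD1 mu) //=.
  exact: leq_trans Ua (leq_addr _ _).
- exists b; rewrite rankW -[X in (_ < X)%N]card_ord -[X in (_ < X)%N]muln1.
  rewrite -sum_nat_const (bigD1 nu) //= [X in (_ < X)%N](bigD1 nu) //=.
  (* The line at [nu] contributes 0 instead of 1, and every other line at most 1. *)
  by rewrite -addSn leq_add // leq_sum.
Qed.

Lemma phi_surj_stable (x : stable_locus k d theta) :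
  exists rt : stable_locus k dt thetat, phi (sval rt) = sval x.
Proof.
have st : stable thetat (covering_rep (sval x)).
  by apply: phi_stable; rewrite covering_repK; apply: svalP.
by exists (exist _ _ st); rewrite /= covering_repK.
Qed.

Lemma phi_same_orbit (rt rt' : rep k dt) :
  same_orbit rt rt' -> same_orbit (phi rt) (phi rt').
Proof.
(* The torus coordinates over [a] become the diagonal of an automorphism of [V_a]. *)
move=> [t ut ->]; pose s a : 'rV_(d a) := \row_mu (t (vx a mu) : 'M[k]_1) 0 0.
have s0 a mu : s a 0 mu != 0.
  have := ut (vx a mu); rewrite mxE -(@row_free_unit _ 1) /row_free.
  by rewrite (rank_mx11 (t (vx a mu) : 'M[k]_1)) eqb1.
exists (fun a => diag_mx (s a)) => [a|].
  by rewrite unitmxE det_diag unitfE; apply/prodf_neq0 => i _; exact: s0.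
apply: functional_extensionality_dep => al; apply/matrixP => i j.
rewrite /rep_act invmx_diag // mul_diag_mx mul_mx_diag phiE !mxE.
by rewrite big_ord1 invmx11E !mxE big_ord1.
Qed.

End CoveringRepresentation.

(** * Morphisms and descent to quotients *)

Lemma open_stable_locus (k : fieldType) (Q : quiver) (d : vertex Q -> nat)
    (theta : vertex Q -> rat) (U : set (stable_locus k d theta)) :
  open U = zariski_open U.
Proof. by []. Qed.

Lemma stable_locus_inj (k : fieldType) (Q : quiver) (d : vertex Q -> nat)
    (theta : vertex Q -> rat) (x y : stable_locus k d theta) :
  sval x = sval y -> x = y.
Proof. by move: x y => [rho ?] [rho' ?] /= ?; apply: eq_exist. Qed.

(** A basic open set, where [h] is non-zero, pulls back to the one of [h \o F], and a local fraction
    pulls back to a fraction of polynomials. *)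
Lemma polynomial_fs_morphism (k : fieldType)
    (Q Q' : quiver) (d : vertex Q -> nat) (d' : vertex Q' -> nat)
    (theta : vertex Q -> rat) (theta' : vertex Q' -> rat)
    (F : rep k d -> rep k d')
    (f : stable_locus k d theta -> stable_locus k d' theta') :
  (forall h, polynomial_fun h -> polynomial_fun (h \o F)) ->
  (forall x, sval (f x) = F (sval x)) -> fs_morphism f.
Proof.
move=> pF fF; split=> [|U u _ ru].
  apply/continuousP => U; rewrite !open_stable_locus => oU x /oU[h [ph hx hU]].
  exists (h \o F); split; [exact: pF | by rewrite /= -fF |].
  by move=> y; rewrite /= -fF => /hU.
move=> x /ru[f1 [h [pf ph hx uE]]].
exists (f1 \o F), (h \o F); split; [exact: pF | exact: pF | by rewrite /= -fF |].
by move=> y Uy; rewrite /= -!fF; apply: uE.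
Qed.

(** A geometric quotient is categorical. *)
Lemma geometric_quotient_desc (k : fieldType) (X N Y : fun_space k)
    (E : X -> X -> Prop) (p : X -> N) (f : X -> Y) :
  geometric_quotient E p -> fs_morphism f ->
  (forall x x', E x x' -> f x = f x') ->
  exists2 tau : N -> Y, fs_morphism tau & f = tau \o p.
Proof.
move=> [psurj pE pO pR] [/continuousP cf rf] fE.
(* Any set-theoretic section will do: [s (p x)] and [x] are [E]-related, so [f] agrees on them. *)
have [s sK] := choice psurj.
have fp : f = (f \o s) \o p.
  by apply: funext => x; apply: fE; apply/pE; rewrite sK.
exists (f \o s) => //; split=> [|U u oU ru].
  by apply/continuousP => U oU; apply/pO; rewrite -comp_preimage -fp; apply: cf.
have oV : open ((f \o s) @^-1` U)%classic.
  by apply/pO; rewrite -comp_preimage -fp; apply: cf.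
apply/(pR _ _ oV); rewrite -comp_preimage -fp.
rewrite (_ : _ \o p = u \o f); last by rewrite [in RHS]fp.
exact: rf.
Qed.

(** As [phi] may destroy stability, there are two forms: a morphism on all of [Nt] when [phi]
    restricts to the stable loci, and otherwise a map of sets on the classes that contain some [rt]
    with [phi rt] stable. *)
Theorem proposition4p4 (k : closedFieldType) (Q : quiver)
    (d : vertex Q -> nat) (d_gt0 : forall a, (0 < d a)%N)
    (theta : vertex Q -> rat)
    (N : fun_space k) (p : stable_locus k d theta -> N)
    (Nt : fun_space k)
    (pt : stable_locus k (cover_dim d_gt0) (cover_weight d_gt0 theta) -> Nt) :
  is_moduli p -> is_moduli pt ->
  (forall phi_s : stable_locus k (cover_dim d_gt0) (cover_weight d_gt0 theta) ->
                  stable_locus k d theta,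
     (forall rt, sval (phi_s rt) = phi (sval rt)) ->
     exists tau : Nt -> N,
       [/\ fs_morphism tau, forall y, exists x, tau x = y
         & p \o phi_s = tau \o pt]) /\
  (exists tau : {x : Nt | exists2 rt, pt rt = x & stable theta (phi (sval rt))}
                -> N,
     (forall y, exists x, tau x = y) /\
     forall rt (hs : stable theta (phi (sval rt))),
       p (exist _ (phi (sval rt)) hs) =
       tau (exist _ (pt rt) (ex_intro2 _ _ rt erefl hs))).
Proof.
move=> mp mpt; have [psurj pE _ _] := mp; have [_ ptE _ _] := mpt.
split=> [phi_s phiE|].
  have phi_fs : fs_morphism phi_s.
    exact: polynomial_fs_morphism (@phi_polynomial k Q d d_gt0) phiE.
  have p_fs : fs_morphism (p \o phi_s).
    have [phi_c phi_r] := phi_fs.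
    have [_ _ pO pR] := mp.
    split=> [|U u oU ru].
      apply/continuousP => U /pO oU; rewrite comp_preimage.
      by move/continuousP: phi_c; apply.
    rewrite comp_preimage compA; apply: phi_r; first exact/pO.
    exact/pR.
  have [|tau tau_fs pE'] := geometric_quotient_desc mpt p_fs.
    move=> rt rt' /phi_same_orbit orb.
    by apply/pE; rewrite /orbit_on_stable !phiE.
  exists tau; split=> // y; have [x <-] := psurj y.
  have [rt rtE] := phi_surj_stable d_gt0 x.
  exists (pt rt); rewrite -[LHS]/((tau \o pt) rt) -pE' /=; congr p.
  by apply: stable_locus_inj; rewrite phiE.
(* A point of the domain only asserts that a representative exists, so [tau] is chosen from the fact
   that all admissible representatives of a class have the same image under [p]. *)
have /choice[tau tauE] :
    forall x : {x | exists2 rt, pt rt = x & stable theta (phi (sval rt))},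
    exists y, forall rt (hs : stable theta (phi (sval rt))),
      pt rt = sval x -> p (exist _ (phi (sval rt)) hs) = y.
  move=> [x /= [rt rtx hs]]; exists (p (exist _ (phi (sval rt)) hs)) => rt' hs'.
  by rewrite -rtx => /ptE/phi_same_orbit orb; apply/pE.
exists tau; split=> [y|rt hs]; last exact: tauE.
have [x <-] := psurj y; have [rt rtE] := phi_surj_stable d_gt0 x.
have hs : stable theta (phi (sval rt)) by rewrite rtE; apply: svalP.
exists (exist _ (pt rt) (ex_intro2 _ _ rt erefl hs)).
by rewrite -(tauE _ rt hs) //; congr p; apply: stable_locus_inj.
Qed.
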